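(* Let $\psi:C_Z\to\mathbb{R}$ be an increasing convex functional such that for every $X\in C_Z$ there exists $\varepsilon>0$ with $\lim_{z\to+\infty}\psi(X+\varepsilon(Z-z)^+)=\psi(X)$. Then $$\psi(X)=\max_{\mu\in ca^+_Z}\big(\langle X,\mu\rangle-\psi^*_{C_Z}(\mu)\big)\quad\text{for all }X\in C_Z,$$ the supremum being attained.
   Context: Fix integers $J\ge0$, $T\ge1$. $\Omega$ is a non-empty subset of $((0,\infty)\times\mathbb{R}^J)^T$ with the Euclidean metric. $Z:\Omega\to[1,\infty)$ is continuous with $\{\omega\in\Omega:Z(\omega)\le z\}$ compact for every $z\in\mathbb{R}_+$. $C_Z$ is the space of continuous $X:\Omega\to\mathbb{R}$ with $X/Z$ bounded. $ca^+_Z$ is the set of (nonnegative) Borel measures $\mu$ on $\Omega$ with $\langle Z,\mu\rangle:=\int Z\,d\mu<\infty$; $\langle X,\mu\rangle=\int X\,d\mu$. $\psi$ increasing means $\psi(X)\ge\psi(Y)$ whenever $X\ge Y$. $\psi^*_{C_Z}(\mu)=\sup_{X\in C_Z}(\langle X,\mu\rangle-\psi(X))$ for $\mu\in ca^+_Z$. *)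

(* Defs.v *)
From HB Require Import structures.
From mathcomp Require Import all_boot all_order all_algebra.
From mathcomp Require Import all_classical all_reals all_analysis.
Set Implicit Arguments. Unset Strict Implicit. Unset Printing Implicit Defensive.
Import Order.TTheory GRing.Theory Num.Theory.
Import numFieldNormedType.Exports.
Local Open Scope classical_set_scope.
Local Open Scope ring_scope.

(* Ambient space ((0,oo) x R^J)^T is embedded in the matrix space
   'M[R]_(T, J.+1): row t is (S_t, theta_t), column 0 being the positive
   coordinate. The matrix topology is the product (= Euclidean) topology. *)
Definition Amb (R : realType) (J T : nat) := 'M[R]_(T, J.+1).

Definition BorelAmb (R : realType) (J T : nat) :=
  g_sigma_algebraType (@open (Amb R J T)).

Definition in_state_space (R : realType) (J T : nat) (Omega : set (Amb R J T)) :=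
  forall x, Omega x -> forall t : 'I_T, 0 < x t ord0.

Definition CZ (R : realType) (J T : nat) (Omega : set (Amb R J T))
  (Z X : Amb R J T -> R) : Prop :=
  {within Omega, continuous X} /\
  exists c : R, forall x, Omega x -> `|X x / Z x| <= c.

Definition pairing (R : realType) (J T : nat) (Omega : set (Amb R J T))
  (X : Amb R J T -> R) (mu : {measure set (BorelAmb R J T) -> \bar R}) : \bar R :=
  (\int[mu]_(x in (Omega : set (BorelAmb R J T))) (X x)%:E)%E.

(* ca^+_Z : (nonnegative) Borel measures on Omega (represented as Borel
   measures on the ambient space carried by Omega) with <Z, mu> < oo *)
Definition caZ (R : realType) (J T : nat) (Omega : set (Amb R J T))
  (Z : Amb R J T -> R) (mu : {measure set (BorelAmb R J T) -> \bar R}) : Prop :=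
  mu (~` (Omega : set (BorelAmb R J T))) = 0%E /\
  (pairing Omega Z mu < +oo)%E.

Definition conj_CZ (R : realType) (J T : nat) (Omega : set (Amb R J T))
  (Z : Amb R J T -> R) (psi : (Amb R J T -> R) -> R)
  (mu : {measure set (BorelAmb R J T) -> \bar R}) : \bar R :=
  ereal_sup [set (pairing Omega X mu - (psi X)%:E)%E | X in CZ Omega Z].

(* Main.v *)
Require Import Defs.
From HB Require Import structures.
From mathcomp Require Import all_boot all_order all_algebra.
From mathcomp Require Import all_classical all_reals all_analysis.
From mathcomp Require Import measurable_realfun lra.
Import Order.TTheory GRing.Theory Num.Theory.
Import numFieldNormedType.Exports.
Local Open Scope classical_set_scope.
Local Open Scope ring_scope.

(** By Hahn-Banach, the convex functional [Y |-> psi (X + Y) - psi X] on C_Z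
dominates a linear functional [phi]. Monotonicity of [psi] makes [phi] positive
and the continuity condition makes [phi ((Z - z)^+)] tend to 0. Since [Z] has
compact sublevel sets, Dini's argument then applies, and [phi] is integration
against a measure [mu] as in the Daniell-Stone theorem. The subgradient
inequality says that [mu] attains the supremum. *)

(** * Linear minorants of convex functionals *)

(** A positive linear functional on C_Z may lose mass at infinity, and is then not an integral. The
    outer content is therefore built from positivity and linearity alone, with covers by increasing
    sequences, so that countable subadditivity and the splitting by open sets come before any
    continuity of [phi]. Smallness of [phi ((Z - z)^+)] is spent exactly twice: to show that [Omega]
    keeps the full mass [phi 1], and to pass from bounded to unbounded functions. In between,
    integrals are only bounded above by [phi]; equality comes from applying the same bound to
    [M - X], which is where the full mass counts. Members of C_Z are functions on the ambient space
    controlled on [Omega] only; positivity makes [phi] ignore their values elsewhere. *)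

Section convex_minorant.
Context {R : realType} {V : lmodType R}.
Variable P : set V.
Hypothesis P0 : P 0.
Hypothesis PL : forall a x y, P x -> P y -> P (a *: x + y).

Let PD x y : P x -> P y -> P (x + y).
Proof. by move=> Px Py; have := PL 1 _ _ Px Py; rewrite scale1r. Qed.

Let PZ a x : P x -> P (a *: x).
Proof. by move=> Px; have := PL a _ _ Px P0; rewrite addr0. Qed.

Let PN x : P x -> P (- x).
Proof. by move=> Px; rewrite -scaleN1r; exact: PZ. Qed.

Definition convex_on (q : V -> R) := forall x y (l : R), P x -> P y ->
  0 <= l <= 1 -> q (l *: x + (1 - l) *: y) <= l * q x + (1 - l) * q y.

Definition normalized_convex_on (q : V -> R) := convex_on q /\ q 0 = 0.

(** Convexity at the midpoint of [x] and [- x]. It gives every [q <= p] the common lower bound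
    [- p (- x)], so that infima over chains are genuine. *)
Lemma normalized_convex_ge_opp q x : normalized_convex_on q -> P x ->
  - q (- x) <= q x.
Proof.
move=> [cq q0] Px; have := cq x (- x) 2^-1 Px (PN _ Px).
have -> : (1 - 2^-1 : R) = 2^-1 by lra.
rewrite scalerN subrr q0 => h.
have := h ltac:(lra); lra.
Qed.

Lemma normalized_convex_scale_le q (t : R) x : normalized_convex_on q -> P x ->
  0 <= t <= 1 -> q (t *: x) <= t * q x.
Proof.
move=> [cq q0] Px t01; have := cq x 0 t Px P0 t01.
by rewrite scaler0 addr0 q0 mulr0 addr0.
Qed.

(** Provides the bounds of chains for Zorn's lemma. An infimum of convex functionals need not be
    convex; in a chain, near-minimizers at [x] and at [y] can be replaced by the smaller of the two,
    which serves both points. *)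
Lemma chain_inf_normalized_convex (p : V -> R) (A : set (V -> R)) :
  A !=set0 ->
  (forall q, A q -> normalized_convex_on q /\ forall x, P x -> q x <= p x) ->
  (forall q r, A q -> A r ->
     (forall x, P x -> q x <= r x) \/ (forall x, P x -> r x <= q x)) ->
  normalized_convex_on (fun x => inf [set q x | q in A]) /\
  forall q, A q -> forall x, P x -> inf [set q x | q in A] <= q x.
Proof.
move=> [q0 Aq0] Acvx Atot.
have lbA x : P x -> lbound [set q x | q in A] (- p (- x)).
  move=> Px _ [q Aq <-]; have [cq qp] := Acvx _ Aq.
  apply: le_trans (normalized_convex_ge_opp _ _ cq Px).
  by rewrite lerN2 qp//; exact: PN.
have infle q x : A q -> P x -> inf [set q x | q in A] <= q x.
  move=> Aq Px; apply: ge_inf; last by exists q.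
  by exists (- p (- x)); exact: lbA.
split; last by move=> q Aq x Px; exact: infle.
split; last first.
  have -> : [set q 0 | q in A] = [set (0:R)].
    apply/seteqP; split => [_ [q Aq <-]|_ ->]; first by have [[_ ->]] := Acvx _ Aq.
    by exists q0 => //; have [[_ ->]] := Acvx _ Aq0.
  by rewrite inf1.
move=> x y l Px Py l01; apply/ler_addgt0Pr => e e0.
have adh z : P z -> exists2 q, A q & q z < inf [set q z | q in A] + e.
  move=> Pz; have [//||_ [q Aq <-] qe] := @inf_adherent _ [set q z | q in A] e.
    split; first by exists (q0 z), q0.
    by exists (- p (- z)); exact: lbA.
  by exists q.
have [q Aq qx] := adh _ Px; have [r Ar ry] := adh _ Py.
have [s [As sq sr]] : exists s, [/\ A s, s x <= q x & s y <= r y].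
  have [h|h] := Atot _ _ Aq Ar; first by exists q; split => //; exact: h.
  by exists r; split => //; exact: h.
have Pl : P (l *: x + (1 - l) *: y) by apply: PL => //; exact: PZ.
apply: le_trans (infle _ _ As Pl) _.
have [[cs _] _] := Acvx _ As.
apply: le_trans (cs _ _ _ Px Py l01) _.
have [l0 l1] := andP l01.
have h1 : l * s x <= l * (inf [set q x | q in A] + e) by apply: ler_wpM2l => //; lra.
have h2 : (1 - l) * s y <= (1 - l) * (inf [set q y | q in A] + e).
  by apply: ler_wpM2l => //; lra.
lra.
Qed.

(* A normalized convex functional that is minimal is linear: first q(t x)/t
   (0 < t <= 1) lies below q, so q is positively homogeneous, hence
   subadditive; then q(. + y) - q(y) lies below q, so q is additive. *)
Lemma linear_minorant (p : V -> R) : normalized_convex_on p ->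
  exists phi : V -> R,
    (forall a x y, P x -> P y -> phi (a *: x + y) = a * phi x + phi y) /\
    (forall x, P x -> phi x <= p x).
Proof.
move=> cp.
pose C := {q : V -> R | normalized_convex_on q /\ forall x, P x -> q x <= p x}.
(* The order is reversed, so that a maximal element is a minimal functional; it is only a preorder,
   as values off [P] do not count. *)
pose below (q r : C) := `[< forall x, P x -> sval r x <= sval q x >].
have [|||[q [cq qp]] qmin] := @ZL_preorder C
    (exist _ p (conj cp (fun _ _ => lexx _))) below.
- by move=> q; apply/asboolP.
- move=> r q s /asboolP rq /asboolP qs; apply/asboolP => x Px.
  by apply: le_trans (rq _ Px); exact: qs.
- move=> A Atot.
  have [->|/set0P[a Aa]] := eqVneq A set0.
    by exists (exist _ p (conj cp (fun _ _ => lexx _))) => s [].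
  have [|||ci ile] := @chain_inf_normalized_convex p [set sval q | q in A].
  + by exists (sval a), a.
  + by move=> _ [[q qP] _ <-].
  + move=> _ _ [q Aq <-] [r Ar <-].
    by case: (Atot _ _ Aq Ar) => /asboolP; [right|left].
  have ip x : P x -> inf [set q x | q in [set sval q | q in A]] <= p x.
    move=> Px; apply: (@le_trans _ _ (sval a x)).
      by apply: ile => //; exists a.
    by case: (svalP a) => _; exact.
  have [qi qiE] : exists qi : C,
      sval qi = fun x => inf [set q x | q in [set sval q | q in A]].
    by exists (exist (fun q => normalized_convex_on q /\ forall x, P x -> q x <= p x)
                 _ (conj ci ip)).
  exists qi => s As; apply/asboolP => x Px; rewrite qiE.
  by apply: ile => //; exists s.
(* Anything below [q] is below [p], hence belongs to [C]: minimality holds against all normalized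
   convex functionals. *)
have {}qmin r : normalized_convex_on r -> (forall x, P x -> r x <= q x) ->
    forall x, P x -> q x <= r x.
  move=> cr rq.
  have rp x : P x -> r x <= p x by move=> Px; exact: le_trans (rq _ Px) (qp _ Px).
  have := qmin (exist _ r (conj cr rp)).
  by rewrite /below/= => h; apply/asboolP/h/asboolP.
have [cvq q0] := cq.
have qhomo1 t x : 0 < t <= 1 -> P x -> q (t *: x) = t * q x.
  move=> /andP[t0 t1] Px.
  have t01 : 0 <= t <= 1 by rewrite ltW.
  apply/eqP; rewrite eq_le; apply/andP; split.
    exact: normalized_convex_scale_le.
  rewrite mulrC -ler_pdivlMr//.
  apply: (qmin (fun x => q (t *: x) / t)) => //; first split.
  - move=> u v l Pu Pv l01.
    rewrite scalerDr !scalerA (mulrC t l) (mulrC t (1 - l)) -!scalerA.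
    rewrite ler_pdivrMr// mulrDl -!mulrA mulVf ?gt_eqF// !mulr1.
    by apply: cvq => //; exact: PZ.
  - by rewrite scaler0 q0 mul0r.
  - move=> y Py; rewrite ler_pdivrMr// mulrC.
    exact: normalized_convex_scale_le.
have qhomo t x : 0 < t -> P x -> q (t *: x) = t * q x.
  move=> t0 Px; have [t1|/ltW t1] := leP t 1; first by rewrite qhomo1// t0.
  have := @qhomo1 t^-1 (t *: x); rewrite scalerA mulVf ?gt_eqF// scale1r => ->.
  - by rewrite mulrA mulfV ?gt_eqF// mul1r.
  - by rewrite invr_gt0 t0 invf_le1.
  - exact: PZ.
have qsub x y : P x -> P y -> q (x + y) <= q x + q y.
  move=> Px Py; have h2 : 0 < (2^-1 : R) by lra.
  have : 0 <= (2^-1 : R) <= 1 by lra.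
  move=> /(cvq x y 2^-1 Px Py).
  have -> : (1 - 2^-1 : R) = 2^-1 by lra.
  rewrite -scalerDr qhomo//; last exact: PD.
  by rewrite -mulrDr ler_pM2l.
have qD x y : P x -> P y -> q (x + y) = q x + q y.
  move=> Px Py; apply/eqP; rewrite eq_le qsub//= -lerBrDr.
  apply: (qmin (fun x => q (x + y) - q y)) => //; first split.
  - move=> u v l Pu Pv l01.
    have -> : l *: u + (1 - l) *: v + y = l *: (u + y) + (1 - l) *: (v + y).
      by rewrite !scalerDr addrACA -scalerDl subrKC scale1r.
    have := cvq (u + y) (v + y) l (PD _ _ Pu Py) (PD _ _ Pv Py) l01.
    lra.
  - by rewrite add0r subrr.
  - by move=> z Pz; rewrite lerBlDr qsub.
have qN x : P x -> q (- x) = - q x.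
  move=> Px; apply/eqP; rewrite -addr_eq0 addrC -qD//; last exact: PN.
  by rewrite subrr q0.
exists q; split => // a x y Px Py; rewrite qD//; last exact: PZ.
congr (_ + _); have [a0|a0|->] := ltgtP a 0.
- rewrite -[a in LHS]opprK scaleNr qN ?qhomo ?oppr_gt0//; last exact: PZ.
  by rewrite mulNr opprK.
- exact: qhomo.
- by rewrite scale0r q0 mul0r.
Qed.

End convex_minorant.

(** * The space C_Z *)

(** The distance to the complement of [U], capped at 1 because it is infinite when [U] is the whole
    space. The functions [min 1 (k d)] then increase to the indicator of [U]. *)
Lemma open_cutoff {R : realType} {T : pseudoMetricType R} (U : set T) :
  open U -> exists d : T -> R, [/\ continuous d, forall x, 0 <= d x,
    forall x, ~ U x -> d x = 0 & forall x, U x -> 0 < d x].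
Proof.
move=> oU; pose h x := mine (edist_inf (~` U) x) 1%E.
have hfin x : h x \is a fin_num.
  rewrite ge0_fin_numE; first by rewrite gt_min ltry orbT.
  by rewrite le_min edist_inf_ge0 lee01.
have ch : continuous h.
  apply: (@min_fun_continuous _ _ (\bar R) (edist_inf (~` U)) (cst 1%E)).
    exact: edist_inf_continuous.
  by move=> x; exact: cvg_cst.
exists (fine \o h); split.
- move=> x; apply: fine_cvg; rewrite fineK//; exact: ch.
- by move=> x /=; rewrite fine_ge0// le_min edist_inf_ge0 lee01.
- by move=> x Ux; rewrite /= /h edist_inf0// min_l.
- move=> x Ux; rewrite /= fine_gt0//; apply/andP; split; last first.
    by have := hfin x; rewrite fin_numElt => /andP[].
  rewrite lt_min lte01 andbT.
  have [e /= e0 eU] := (nbhs_ballP x U).1 (open_nbhs_nbhs (conj oU Ux)).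
  apply: (@lt_le_trans _ _ e%:E); first by rewrite lte_fin.
  apply: le_ereal_inf_tmp => _ [y Uy <-].
  rewrite leNgt; apply/negP => dlt; apply: Uy; apply: eU.
  exact: edist_lt_ball dlt.
Qed.

Section CZ_closure.
Context {R : realType} {J T : nat}.
Variables (Omega : set (Amb R J T)) (Z : Amb R J T -> R).
Hypothesis Z1 : forall x, Omega x -> 1 <= Z x.
Hypothesis cZ : {within Omega, continuous Z}.

Lemma CZP X : CZ Omega Z X <-> {within Omega, continuous X} /\
  exists2 c : R, 0 <= c & forall x, Omega x -> `|X x| <= c * Z x.
Proof.
split=> [[cX [c cP]]|[cX [c c0 h]]]; split => //.
  exists `|c| => // x Ox; have Zx : 0 < Z x by apply: lt_le_trans (Z1 _ Ox).
  have := cP x Ox; rewrite normrM normfV (gtr0_norm Zx) ler_pdivrMr// => /le_trans.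
  by apply; rewrite ler_pM2r// ler_norm.
exists c => x Ox; have Zx : 0 < Z x by apply: lt_le_trans (Z1 _ Ox).
by rewrite normrM normfV (gtr0_norm Zx) ler_pdivrMr// h.
Qed.

Lemma CZ_dominated (X Y : Amb R J T -> R) : {within Omega, continuous X} ->
  CZ Omega Z Y -> (forall x, Omega x -> `|X x| <= `|Y x|) -> CZ Omega Z X.
Proof.
move=> cX /CZP[cY [c c0 cP]] XY; apply/CZP; split => //; exists c => // x Ox.
exact: le_trans (XY _ Ox) (cP _ Ox).
Qed.

Lemma CZ_lin a (X Y : Amb R J T -> R) : CZ Omega Z X -> CZ Omega Z Y ->
  CZ Omega Z (fun x => a * X x + Y x).
Proof.
move=> /CZP[cX [c c0 cP]] /CZP[cY [d d0 dP]]; apply/CZP; split.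
  move=> x; apply: cvgD; last exact: cY.
  by apply: cvgM; [exact: cvg_cst|exact: cX].
exists (`|a| * c + d); first by rewrite addr_ge0// mulr_ge0.
move=> x Ox; apply: le_trans (ler_normD _ _) _.
by rewrite mulrDl lerD// ?dP// normrM -mulrA ler_wpM2l// cP.
Qed.

Lemma CZ_Z : CZ Omega Z Z.
Proof.
apply/CZP; split => //; exists 1 => // x Ox; rewrite mul1r ger0_norm//.
exact: le_trans (Z1 _ Ox).
Qed.

Lemma CZ_cst (c : R) : CZ Omega Z (fun=> c).
Proof.
apply/CZP; split; first by move=> x; exact: cvg_cst.
by exists `|c| => // x Ox; rewrite ler_peMr// Z1.
Qed.

Lemma CZ_D (X Y : Amb R J T -> R) : CZ Omega Z X -> CZ Omega Z Y ->
  CZ Omega Z (fun x => X x + Y x).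
Proof.
move=> hX hY; have := CZ_lin 1 _ _ hX hY.
by congr CZ; apply/funext => x; rewrite mul1r.
Qed.

Lemma CZ_B (X Y : Amb R J T -> R) : CZ Omega Z X -> CZ Omega Z Y ->
  CZ Omega Z (fun x => X x - Y x).
Proof.
move=> hX hY; have := CZ_lin (-1) _ _ hY hX.
by congr CZ; apply/funext => x; rewrite mulN1r addrC.
Qed.

Lemma CZ_scale a (X : Amb R J T -> R) : CZ Omega Z X ->
  CZ Omega Z (fun x => a * X x).
Proof.
move=> hX; have := CZ_lin a _ _ hX (CZ_cst 0).
by congr CZ; apply/funext => x; rewrite addr0.
Qed.

Lemma CZ_max (X Y : Amb R J T -> R) : CZ Omega Z X -> CZ Omega Z Y ->
  CZ Omega Z (fun x => Num.max (X x) (Y x)).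
Proof.
move=> /CZP[cX [c c0 cP]] /CZP[cY [d d0 dP]]; apply/CZP; split.
  by move=> x; apply: continuous_max; [exact: cX|exact: cY].
exists (c + d); first exact: addr_ge0.
move=> x Ox; have Zx : 0 <= Z x by apply: le_trans (Z1 _ Ox).
rewrite mulrDl; have [_|_] := leP (X x) (Y x).
  by apply: le_trans (dP _ Ox) _; rewrite lerDr mulr_ge0.
by apply: le_trans (cP _ Ox) _; rewrite lerDl mulr_ge0.
Qed.

Lemma CZ_min (X Y : Amb R J T -> R) : CZ Omega Z X -> CZ Omega Z Y ->
  CZ Omega Z (fun x => Num.min (X x) (Y x)).
Proof.
move=> hX hY; have := CZ_B _ _ (CZ_D _ _ hX hY) (CZ_max _ _ hX hY).
by congr CZ; apply/funext => x; have [_|_] := leP (X x) (Y x);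
  [rewrite addrK|rewrite addrC addKr].
Qed.

Lemma CZ_mul_cutoff (X g : Amb R J T -> R) : CZ Omega Z X ->
  {within Omega, continuous g} -> (forall x, Omega x -> 0 <= g x <= 1) ->
  CZ Omega Z (fun x => X x * g x).
Proof.
move=> hX cg g01; apply: (CZ_dominated _ _ _ hX).
  by move=> x; apply: cvgM; [exact: hX.1|exact: cg].
move=> x Ox; have /andP[g0 g1] := g01 _ Ox.
by rewrite normrM (ger0_norm g0) ler_piMr.
Qed.

End CZ_closure.

(** * The outer content of a positive linear functional *)

Section daniell.
Context {R : realType} {J T : nat}.
Variables (Omega : set (Amb R J T)) (Z : Amb R J T -> R).
Hypothesis Z1 : forall x, Omega x -> 1 <= Z x.
Hypothesis cZ : {within Omega, continuous Z}.
Hypothesis Zcompact :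
  forall z : R, 0 <= z -> compact [set x | Omega x /\ Z x <= z].
Variable phi : (Amb R J T -> R) -> R.
Hypothesis phi_lin : forall a X Y, CZ Omega Z X -> CZ Omega Z Y ->
  phi (fun x => a * X x + Y x) = a * phi X + phi Y.
Hypothesis phi_ge0 : forall X, CZ Omega Z X ->
  (forall x, Omega x -> 0 <= X x) -> 0 <= phi X.
Hypothesis phi_tail : forall e : R, 0 < e ->
  exists2 z : R, 0 <= z & phi (fun x => Num.max (Z x - z) 0) <= e.

Lemma positive_functionalD X Y : CZ Omega Z X -> CZ Omega Z Y ->
  phi (fun x => X x + Y x) = phi X + phi Y.
Proof.
move=> hX hY; rewrite -[phi X]mul1r -phi_lin//.
by congr phi; apply/funext => x; rewrite mul1r.
Qed.

Lemma positive_functionalB X Y : CZ Omega Z X -> CZ Omega Z Y ->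
  phi (fun x => X x - Y x) = phi X - phi Y.
Proof.
move=> hX hY; rewrite addrC -mulN1r -phi_lin//.
by congr phi; apply/funext => x; rewrite mulN1r addrC.
Qed.

Lemma positive_functional0 : phi (fun=> 0) = 0.
Proof.
have := positive_functionalB _ _ (CZ_cst _ _ Z1 0) (CZ_cst _ _ Z1 0).
rewrite [RHS]subrr => h; rewrite -[RHS]h; congr phi.
by apply/funext => x; rewrite subrr.
Qed.

Lemma positive_functionalZ a X : CZ Omega Z X -> phi (fun x => a * X x) = a * phi X.
Proof.
move=> hX; rewrite -[RHS]addr0 -positive_functional0 -phi_lin//; last exact: CZ_cst.
by congr phi; apply/funext => x; rewrite addr0.
Qed.

Lemma positive_functional_le X Y : CZ Omega Z X -> CZ Omega Z Y ->
  (forall x, Omega x -> X x <= Y x) -> phi X <= phi Y.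
Proof.
move=> hX hY XY; rewrite -subr_ge0 -positive_functionalB//; apply: phi_ge0.
  exact: CZ_B.
by move=> x Ox; rewrite subr_ge0 XY.
Qed.

(** The limit of the sequence stands for a lower semicontinuous majorant of the indicator of [A],
    which C_Z itself need not contain. Reaching 1 at a finite index lets Dini's argument start from
    a single continuous function near each point. *)
Definition covers (A : set (Amb R J T)) (F : nat -> Amb R J T -> R) :=
  [/\ forall n, CZ Omega Z (F n),
      forall n x, Omega x -> 0 <= F n x,
      forall n x, Omega x -> F n x <= F n.+1 x &
      forall x, A x -> Omega x -> exists n, 1 <= F n x].

Lemma covers_homo A F x n m : covers A F -> Omega x -> (n <= m)%N ->
  F n x <= F m x.
Proof.
move=> [_ _ inc _] Ox nm.
apply: (@homo_leq _ (F^~ x) (fun a b => a <= b)) nm => [a|a b c|k].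
- exact: lexx.
- exact: le_trans.
- exact: inc.
Qed.

Lemma covers_cst A X : CZ Omega Z X -> (forall x, Omega x -> 0 <= X x) ->
  (forall x, A x -> Omega x -> 1 <= X x) -> covers A (fun=> X).
Proof.
move=> hX X0 X1; split => // x Ax Ox.
by exists 0%N; exact: X1.
Qed.

(** The Daniell outer measure: [s] bounds [phi] along a cover, so this is the infimum of the suprema
    of [phi (F n)]. The constant cover 1 keeps it real-valued on every subset of the ambient
    space. *)
Definition upper_content (A : set (Amb R J T)) : R :=
  inf [set s | exists2 F, covers A F & forall n, phi (F n) <= s].

Let lb0 A : lbound [set s | exists2 F, covers A F & forall n, phi (F n) <= s] 0.
Proof.
move=> s [F [FC F0 _ _] Fs]; apply: le_trans (Fs 0%N).
by apply: phi_ge0 => // x; exact: F0.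
Qed.

Lemma upper_content_le A F s : covers A F -> (forall n, phi (F n) <= s) ->
  upper_content A <= s.
Proof.
by move=> cF Fs; apply: ge_inf; [exists 0; exact: lb0|exists F].
Qed.

Lemma upper_content_adherent A (e : R) : 0 < e ->
  exists2 F, covers A F & forall n, phi (F n) <= upper_content A + e.
Proof.
move=> e0; have [//||s [F cF Fs] se] :=
  @inf_adherent _ [set s | exists2 F, covers A F & forall n, phi (F n) <= s] e.
  split; last by exists 0; exact: lb0.
  exists (phi (fun=> 1)), (fun=> cst 1) => //.
  by apply: covers_cst => //; exact: CZ_cst.
by exists F => // n; apply: le_trans (Fs n) (ltW se).
Qed.

Lemma upper_content_ge0 A : 0 <= upper_content A.
Proof.
apply: lb_le_inf; last exact: lb0.
by have [F cF Fs] := upper_content_adherent A _ ltr01; exists (upper_content A + 1), F.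
Qed.

(** The zero sequence is a cover. This serves the empty set and also the complement of [Omega], so
    that the measure is carried by [Omega]. *)
Lemma upper_content_null A : (forall x, A x -> ~ Omega x) ->
  upper_content A = 0.
Proof.
move=> AO; apply/eqP; rewrite eq_le upper_content_ge0 andbT.
apply: (@upper_content_le _ (fun=> cst 0)); last by rewrite positive_functional0.
by apply: covers_cst => //; [exact: CZ_cst|move=> x /AO].
Qed.

Lemma upper_content_leT A : upper_content A <= phi (fun=> 1).
Proof.
apply: (@upper_content_le _ (fun=> cst 1)) => //.
by apply: covers_cst => //; exact: CZ_cst.
Qed.

(** The constant sequence [X / c] is a cover. This is the lower bound on [phi] behind the slicing
    estimate. *)
Lemma upper_content_markov X (c : R) : 0 < c -> CZ Omega Z X ->
  (forall x, Omega x -> 0 <= X x) ->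
  c * upper_content [set x | Omega x /\ c <= X x] <= phi X.
Proof.
move=> c0 hX X0; rewrite -ler_pdivlMl//.
apply: (@upper_content_le _ (fun=> fun x => c^-1 * X x)).
  apply: covers_cst; first exact: CZ_scale.
    by move=> x Ox; rewrite mulr_ge0 ?X0// invr_ge0 ltW.
  by move=> x [_ cX] _; rewrite ler_pdivlMl// mulr1.
by move=> _; rewrite positive_functionalZ.
Qed.

Lemma upper_contentS A B : A `<=` B -> upper_content A <= upper_content B.
Proof.
move=> AB; apply/ler_addgt0Pr => e e0.
have [F [FC F0 Finc FB] Fs] := upper_content_adherent B _ e0.
by apply: upper_content_le Fs; split => // x /AB; exact: FB.
Qed.

Let CZ_sum n (F : nat -> Amb R J T -> R) : (forall i, CZ Omega Z (F i)) ->
  CZ Omega Z (fun x => \sum_(i < n) F i x) /\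
  phi (fun x => \sum_(i < n) F i x) = \sum_(i < n) phi (F i).
Proof.
move=> FC; elim: n => [|n [ihC ihphi]].
  have -> : (fun x => \sum_(i < 0) F i x) = fun=> 0.
    by apply/funext => x; rewrite big_ord0.
  by rewrite big_ord0; split; [exact: CZ_cst|exact: positive_functional0].
have -> : (fun x => \sum_(i < n.+1) F i x) =
    fun x => (\sum_(i < n) F i x) + F n x.
  by apply/funext => x; rewrite big_ord_recr.
by split; [exact: CZ_D|rewrite positive_functionalD// ihphi big_ord_recr].
Qed.

(** With covers [F i] of [A i] optimal up to [e / 2 ^+ i.+1], the diagonal sums of [F i n] over
    [i < n] cover the union: they grow with [n] both in the number of terms and in each term.
    Bounding all partial sums by [r] keeps the statement within the reals. *)
Lemma upper_content_bigcup (A : nat -> set (Amb R J T)) (r : R) :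
  (forall n, \sum_(i < n) upper_content (A i) <= r) ->
  upper_content (\bigcup_i A i) <= r.
Proof.
move=> sumr; apply/ler_addgt0Pr => e e0.
have hpos i : 0 < e / 2 ^+ i.+1 by rewrite divr_gt0// exprn_gt0.
have /choice[F FP] i : exists F, covers (A i) F /\
    forall n, phi (F n) <= upper_content (A i) + e / 2 ^+ i.+1.
  by have [F cF Fs] := upper_content_adherent (A i) _ (hpos i); exists F.
have FC i n : CZ Omega Z (F i n) by have [[]] := FP i.
have F0 i n x : Omega x -> 0 <= F i n x.
  by have [[_ h _ _] _] := FP i; exact: h.
have geo n : \sum_(i < n) e / 2 ^+ i.+1 = e - e / 2 ^+ n.
  elim: n => [|n ih]; first by rewrite big_ord0 expr0 divr1 subrr.
  rewrite big_ord_recr/= ih exprS invfM.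
  have : 0 < (2 ^+ n : R)^-1 by rewrite invr_gt0 exprn_gt0.
  set t := (2 ^+ n)^-1 => _; lra.
apply: (@upper_content_le _ (fun n x => \sum_(i < n) F i n x)).
  split.
  - by move=> n; have [] := CZ_sum n (F^~ n) (fun i => FC i n).
  - by move=> n x Ox; apply: sumr_ge0 => i _; exact: F0.
  - move=> n x Ox; rewrite big_ord_recr/= -[leLHS]addr0 lerD ?F0//.
    apply: ler_sum => i _; apply: covers_homo (leqnSn n) => //.
    exact: (FP i).1.
  - move=> x [i _ Aix] Ox; have [[_ _ _ /(_ _ Aix Ox)[k Fk]] _] := FP i.
    (* The index must exceed [i] for [F i] to occur in the sum, and reach [k] for [F i] to be at
       least 1 there. *)
    exists (maxn k i.+1); apply: le_trans Fk _.
    have ilt : (i < maxn k i.+1)%N by rewrite leq_max leqnn orbT.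
    rewrite (bigD1 (Ordinal ilt))//= -[leLHS]addr0 lerD//.
      by apply: covers_homo (leq_maxl _ _) => //; exact: (FP i).1.
    by apply: sumr_ge0 => j _; exact: F0.
move=> n; have [_ ->] := CZ_sum n (F^~ n) (fun i => FC i n).
apply: (@le_trans _ _ (\sum_(i < n) (upper_content (A i) + e / 2 ^+ i.+1))).
  by apply: ler_sum => i _; exact: (FP i).2.
rewrite big_split/=; apply: lerD; first exact: sumr.
by rewrite geo gerBl divr_ge0 ?exprn_ge0// ltW.
Qed.

(* With [g k] the cutoffs increasing to the indicator of [U] and [F] covering
   [E], the diagonal [F k * g k] covers the part of [E] inside [U] and
   [F n * (1 - g k)], for fixed [k], the part outside. *)
Lemma upper_content_split (U E : set (Amb R J T)) : open U ->
  upper_content (E `&` U) + upper_content (E `&` ~` U) <= upper_content E.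
Proof.
move=> oU; apply/ler_addgt0Pr => e e0.
have [F cF] := upper_content_adherent E _ e0.
set S := upper_content E + e => FS.
have [FC F0 Finc FE] := cF.
have [d [cd d0 dU dpos]] := open_cutoff U oU.
pose g (k : nat) x := Num.min 1 (k%:R * d x).
have g01 k x : 0 <= g k x <= 1.
  by rewrite le_min ler01 ge_min lexx/= andbT mulr_ge0.
have cg k : {within Omega, continuous (g k)}.
  move=> x.
  apply: (@continuous_min R (subspace Omega) (fun=> 1) (fun y => k%:R * d y)).
    exact: cvg_cst.
  by apply: cvgM; [exact: cvg_cst|exact: (continuous_subspaceT cd)].
have ginc k l x : (k <= l)%N -> g k x <= g l x.
  move=> kl; rewrite le_min !ge_min lexx/= ler_wpM2r ?ler_nat ?orbT//.
have FgC n k : CZ Omega Z (fun x => F n x * g k x).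
  by apply: CZ_mul_cutoff => // x _; exact: g01.
have Fg1 n k : (fun x => F n x * (1 - g k x)) = fun x => F n x - F n x * g k x.
  by apply/funext => x; rewrite mulrBr mulr1.
have FghC n k : CZ Omega Z (fun x => F n x * (1 - g k x)).
  by rewrite Fg1; exact: CZ_B.
have outside k : upper_content (E `&` ~` U) <= S - phi (fun x => F k x * g k x).
  apply: (@upper_content_le _ (fun n x => F n x * (1 - g k x))).
    split.
    - by move=> n; exact: FghC.
    - move=> n x Ox; have /andP[_ g1] := g01 k x.
      by rewrite mulr_ge0 ?F0// subr_ge0.
    - move=> n x Ox; have /andP[_ g1] := g01 k x.
      by rewrite ler_wpM2r ?subr_ge0// Finc.
    - move=> x [Ex Ux] Ox; have [n Fn] := FE _ Ex Ox.
      by exists n; rewrite /g dU// mulr0 min_r ?ler01// subr0 mulr1.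
  (* At index [maxn n k] the product expands into a difference whose first term is at most [S] and
     whose second is at least [phi (F k * g k)]. *)
  move=> n; apply: (@le_trans _ _ (phi (fun x => F (maxn n k) x * (1 - g k x)))).
    apply: positive_functional_le => // x Ox; have /andP[_ g1] := g01 k x.
    by rewrite ler_wpM2r ?subr_ge0//; apply: covers_homo cF Ox (leq_maxl _ _).
  rewrite Fg1 positive_functionalB// lerB//; apply: positive_functional_le => // x Ox.
  have /andP[g0 _] := g01 k x.
  by rewrite ler_wpM2r//; apply: covers_homo cF Ox (leq_maxr _ _).
rewrite -lerBrDr; apply: (@upper_content_le _ (fun k x => F k x * g k x)).
  split.
  - by move=> n; exact: FgC.
  - by move=> n x Ox; have /andP[g0 _] := g01 n x; rewrite mulr_ge0 ?F0.
  - move=> n x Ox; have /andP[g0 _] := g01 n x.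
    by rewrite ler_pM ?F0 ?Finc// ginc.
  - move=> x [Ex Ux] Ox; have [n Fn] := FE _ Ex Ox.
    have [k dk] : exists k : nat, 1 <= k%:R * d x.
      exists (Num.truncn (d x)^-1).+1; rewrite -ler_pdivrMr ?dpos// mul1r.
      by apply/ltW/truncnS_gt.
    exists (maxn n k); have -> : g (maxn n k) x = 1.
      apply/min_idPl/(le_trans dk); rewrite ler_wpM2r ?ler_nat//.
      exact: leq_maxr.
    rewrite mulr1; apply: le_trans Fn _.
    exact: covers_homo cF Ox (leq_maxl _ _).
by move=> k; rewrite lerBrDr addrC -lerBrDr; exact: outside.
Qed.

(* Dini on the compact sublevel sets of [Z]; the tails are negligible by
   [phi_tail]. *)
Lemma upper_content_full : upper_content Omega = phi (fun=> 1).
Proof.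
apply/eqP; rewrite eq_le upper_content_leT/=.
have phi1 : 0 <= phi (fun=> 1) by apply: phi_ge0 => //; exact: CZ_cst.
apply/ler_addgt0Pr => e e0.
have e3 : 0 < e / 3 by lra.
have [F cF] := upper_content_adherent Omega _ e3.
have [FC F0 Finc FE] := cF => FS.
have [z z0 tailz] := phi_tail _ e3.
(* One third of [e] each for the cover, the tail and the Dini defect: [delta * phi 1 <= e / 3], the
   added 1 keeping the divisor positive. *)
pose delta := e / 3 / (phi (fun=> 1) + 1).
have delta0 : 0 < delta by rewrite divr_gt0//; lra.
(* The level is [z + 1] because beyond it the tail [(Z - z)^+] alone dominates the constant 1. *)
have [n Fn] : exists n, forall x, Omega x -> Z x <= z + 1 -> 1 - delta <= F n x.
  have z10 : 0 <= z + 1 by lra.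
  have /compact_near_coveringP/near_covering_withinP := Zcompact _ z10.
  move=> /(_ nat \oo (fun n x => 1 - delta <= F n x) _)[].
    move=> x [Ox Zx]; have [N FN] := FE _ Ox Ox.
    have cN : \forall y \near x, Omega y -> 1 - delta < F N y.
      have := (FC N).1; rewrite subspace_continuousP => /(_ _ Ox).
      move=> /(_ [set y | 1 - delta < y]); apply.
      apply: open_nbhs_nbhs; split; first exact: open_gt.
      by apply: lt_le_trans FN; rewrite gtrBl.
    exists ([set y | Omega y -> 1 - delta < F N y], [set n | (N <= n)%N]).
      by split => //; exact: nbhs_infty_ge.
    move=> [y n] /= [hy Nn] [Oy _]; apply: le_trans (ltW (hy Oy)) _.
    exact: covers_homo cF Oy Nn.
  by move=> n _ /(_ n) h; exists n => x Ox Zx; apply: h => /=.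
have CZtail : CZ Omega Z (fun x => Num.max (Z x - z) 0).
  apply: CZ_max => //; last exact: CZ_cst.
  by apply: CZ_B => //; [exact: CZ_Z|exact: CZ_cst].
have Cdelta : CZ Omega Z (fun=> delta * 1) by apply: CZ_cst.
have : phi (fun=> 1) <=
    phi (fun x => F n x + (delta * 1 + Num.max (Z x - z) 0)).
  apply: positive_functional_le; first exact: CZ_cst.
    by apply: CZ_D => //; exact: CZ_D.
  move=> x Ox; have [Zx|Zx] := leP (Z x) (z + 1).
    have := Fn x Ox Zx; have : 0 <= Num.max (Z x - z) 0 by rewrite le_max lexx orbT.
    by move=> h1 h2; lra.
  have : 1 <= Num.max (Z x - z) 0 by rewrite le_max; apply/orP; left; move: Zx; lra.
  by have := F0 n x Ox; lra.
rewrite positive_functionalD//; last exact: CZ_D.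
rewrite positive_functionalD// (positive_functionalZ delta (fun=> 1)); last exact: CZ_cst.
have : delta * phi (fun=> 1) <= e / 3.
  by rewrite /delta mulrAC ler_pdivrMr; [rewrite ler_pM2l//|]; lra.
have := FS n; lra.
Qed.

End daniell.

(** * Borel measures from outer contents *)

Section borel_measure_of_content.
Context {R : realType} {T : ptopologicalType}.
Variable c : set T -> R.
Hypothesis c0 : c set0 = 0.
Hypothesis c_ge0 : forall A, 0 <= c A.
Hypothesis cS : forall A B, A `<=` B -> c A <= c B.
Hypothesis c_bigcup : forall (A : nat -> set T) (r : R),
  (forall n, \sum_(i < n) c (A i) <= r) -> c (\bigcup_i A i) <= r.
Hypothesis c_open : forall U E, open U -> c (E `&` U) + c (E `&` ~` U) <= c E.

(** Carathéodory's construction: [c_open] makes open sets, hence Borel sets, measurable for the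
    outer measure [c]. The underlying function of [mu] is [c] itself, so the equality holds for
    every [A], while additivity concerns Borel sets only. *)
Lemma borel_measure_of_content :
  exists mu : {measure set (g_sigma_algebraType (@open T)) -> \bar R},
    forall A, mu A = (c A)%:E.
Proof.
pose f (A : set T) := (c A)%:E.
have f0 : f set0 = 0%E by rewrite /f c0.
have f_ge0 A : (0 <= f A)%E by rewrite lee_fin.
have fS : {homo f : A B / A `<=` B >-> (A <= B)%E}.
  by move=> A B AB; rewrite lee_fin cS.
have f_sub : sigma_subadditive f.
  move=> A.
  have S0 : (0 <= \sum_(i <oo) f (A i))%E by apply: nneseries_ge0 => n _ _.
  have [Sfin|] := ltP (\sum_(i <oo) f (A i))%E +oo%E; last first.
    by rewrite leye_eq => /eqP ->; rewrite leey.
  rewrite -(@fineK _ (\sum_(i <oo) f (A i))%E) ?ge0_fin_numE//.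
  rewrite lee_fin; apply: c_bigcup => n.
  rewrite -lee_fin fineK ?ge0_fin_numE// -sumEFin.
  rewrite -(big_mkord xpredT (fun i => f (A i))).
  exact: nneseries_lim_ge.
pose m : {outer_measure set T -> \bar R} := 
  HB.pack f (isOuterMeasure.Build R T f f0 f_ge0 fS f_sub).
have borel_cara : <<s @open T>> `<=` m.-cara.-measurable.
  apply: smallest_sub; first exact: sigma_algebra_measurable.
  move=> U oU; apply: le_caratheodory_measurable => E.
  by rewrite /m/= /f -EFinD lee_fin c_open.
have f_sadd : semi_sigma_additive
    (f : set (g_sigma_algebraType (@open T)) -> \bar R).
  move=> A mA tA mU.
  apply: (@caratheodory_measure_sigma_additive R T m) => //.
    by move=> n; exact: (borel_cara _ (mA n)).
  exact: (borel_cara _ mU).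
pose mu : {measure set (g_sigma_algebraType (@open T)) -> \bar R} :=
  HB.pack (f : set (g_sigma_algebraType (@open T)) -> \bar R)
    (isMeasure.Build _ (g_sigma_algebraType (@open T)) R f f0 f_ge0 f_sadd).
by exists mu.
Qed.

End borel_measure_of_content.

(** * Integral representation *)

Section representation.
Context {R : realType} {J T : nat}.
Variables (Omega : set (Amb R J T)) (Z : Amb R J T -> R).
Hypothesis Z1 : forall x, Omega x -> 1 <= Z x.
Hypothesis cZ : {within Omega, continuous Z}.
Hypothesis Zcompact :
  forall z : R, 0 <= z -> compact [set x | Omega x /\ Z x <= z].

(** [Omega] is the union of the compact sets [Z <= n], which are closed in the Hausdorff matrix
    space. *)
Lemma measurable_Omega : measurable (Omega : set (BorelAmb R J T)).
Proof.
have -> : Omega = \bigcup_n [set x | Omega x /\ Z x <= n%:R].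
  apply/seteqP; split => [x Ox|x [n _ []]//].
  exists (Num.truncn (Z x)).+1 => //; split => //.
  exact/ltW/truncnS_gt.
apply: bigcupT_measurable => n.
rewrite -[X in measurable X]setCK; apply: measurableC.
apply: sub_sigma_algebra; apply: closed_openC.
by apply: compact_closed; [exact: norm_hausdorff|exact: Zcompact].
Qed.

Lemma CZ_measurable X : CZ Omega Z X ->
  measurable_fun (Omega : set (BorelAmb R J T)) (X : BorelAmb R J T -> R).
Proof.
move=> [cX _]; apply: (measurability _ (RGenOInfty.measurableE R)).
move=> _ [_ [r ->] <-].
have /continuousP/(_ `]r, +oo[%classic) := cX.
move=> /(_ (rray_open _)) /open_subspaceP[V oV VO].
rewrite setIC; have -> : X @^-1` `]r, +oo[%classic `&` Omega = V `&` Omega by [].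
apply: measurableI; last exact: measurable_Omega.
exact: sub_sigma_algebra.
Qed.

Variable phi : (Amb R J T -> R) -> R.
Hypothesis phi_lin : forall a X Y, CZ Omega Z X -> CZ Omega Z Y ->
  phi (fun x => a * X x + Y x) = a * phi X + phi Y.
Hypothesis phi_ge0 : forall X, CZ Omega Z X ->
  (forall x, Omega x -> 0 <= X x) -> 0 <= phi X.
Hypothesis phi_tail : forall e : R, 0 < e ->
  exists2 z : R, 0 <= z & phi (fun x => Num.max (Z x - z) 0) <= e.
Variable mu : {measure set (BorelAmb R J T) -> \bar R}.
Hypothesis muE : forall A, mu A = (upper_content Omega Z phi A)%:E.

Let mO := measurable_Omega.

Let mX X : CZ Omega Z X -> measurable_fun (Omega : set (BorelAmb R J T))
  (fun x : BorelAmb R J T => (X x)%:E).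
Proof. by move=> hX; apply/measurable_EFinP; exact: CZ_measurable. Qed.

Lemma pairingD_ge0 X Y : CZ Omega Z X -> CZ Omega Z Y ->
  (forall x, Omega x -> 0 <= X x) -> (forall x, Omega x -> 0 <= Y x) ->
  pairing Omega (fun x => X x + Y x) mu =
  (pairing Omega X mu + pairing Omega Y mu)%E.
Proof.
move=> hX hY X0 Y0; rewrite /pairing -ge0_integralD//; exact: mX.
Qed.

Lemma pairing_ge0 X : (forall x, Omega x -> 0 <= X x) ->
  (0 <= pairing Omega X mu)%E.
Proof. by move=> X0; apply: integral_ge0 => x Ox; rewrite lee_fin X0. Qed.

(** The total mass of [mu] is [phi 1]: this is where Dini's argument reaches the integrals. *)
Lemma pairing_cst (c : R) : pairing Omega (fun=> c) mu = (c * phi (fun=> 1))%:E.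
Proof.
rewrite /pairing integral_cst// EFinM; congr (_ * _)%E.
by rewrite muE upper_content_full.
Qed.

Lemma pairing_le X Y : CZ Omega Z X -> CZ Omega Z Y ->
  (forall x, Omega x -> 0 <= X x) -> (forall x, Omega x -> X x <= Y x) ->
  (pairing Omega X mu <= pairing Omega Y mu)%E.
Proof.
by move=> hX hY X0 XY; apply: ge0_le_integral => //; exact: mX.
Qed.

(* Slicing at height [eps]: each slice [min X eps] is compared with the measure
   of [0 < X] from above and, by Markov, of [eps <= X] from below; the
   comparisons telescope. *)
Lemma pairing_le_sliced (eps : R) (n : nat) X : 0 < eps -> CZ Omega Z X ->
  (forall x, Omega x -> 0 <= X x <= n%:R * eps) ->
  (pairing Omega X mu <=
   (phi X + eps * upper_content Omega Z phi [set x | Omega x /\ (0 < X x)%R])%:E)%E.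
Proof.
move=> e0; elim: n X => [|n ih] X hX X0n.
  have -> : pairing Omega X mu = 0%E.
    apply: integral0_eq => x Ox; have := X0n x Ox; rewrite mul0r.
    by move=> /le_anti <-.
  rewrite lee_fin addr_ge0//.
    by apply: phi_ge0 => // x /X0n /andP[].
  by apply: mulr_ge0; [exact: ltW|exact: upper_content_ge0].
have X0 x : Omega x -> 0 <= X x by move=> /X0n /andP[].
pose X1 x := Num.max (X x - eps) 0.
pose X2 x := Num.min (X x) eps.
have hX1 : CZ Omega Z X1.
  apply: CZ_max => //; last exact: CZ_cst.
  by apply: CZ_B => //; exact: CZ_cst.
have hX2 : CZ Omega Z X2 by apply: CZ_min => //; exact: CZ_cst.
have X12 : X = fun x => X1 x + X2 x.
  apply/funext => x; rewrite /X1 /X2.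
  have [Xe|Xe] := leP (X x) eps.
    by rewrite max_r ?add0r// subr_le0.
  by rewrite max_l ?subrK// subr_ge0 ltW.
have X1n x : Omega x -> 0 <= X1 x <= n%:R * eps.
  move=> Ox; have /andP[_ Xn] := X0n x Ox.
  rewrite /X1 le_max lexx orbT/= ge_max; apply/andP; split; last first.
    by rewrite mulr_ge0// ltW.
  by rewrite lerBlDr; move: Xn; rewrite -natr1 mulrDl mul1r.
have X20 x : Omega x -> 0 <= X2 x.
  by move=> Ox; rewrite /X2 le_min X0// ltW.
rewrite [in leLHS]X12 pairingD_ge0//; last by move=> x /X1n /andP[].
set A := [set x | Omega x /\ (0 < X x)%R].
have mA : measurable (A : set (BorelAmb R J T)).
  have -> : A = Omega `&` X @^-1` `]0, +oo[%classic.
    by apply/seteqP; split => x /=; rewrite in_itv/= andbT.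
  exact: CZ_measurable.
have sliceE : (pairing Omega X2 mu <= (eps * upper_content Omega Z phi A)%:E)%E.
  rewrite EFinM -muE -[X in mu X](@setIidl _ _ Omega); last by move=> x [].
  rewrite -integral_indic// -ge0_integralZl_EFin//; last 2 first.
  - by apply/measurable_EFinP; exact: measurable_indic.
  - exact: ltW.
  apply: (ge0_le_integral mu mO _ (mX _ hX2)).
  - by move=> x Ox; rewrite lee_fin X20.
  - apply: measurable_funeM; apply/measurable_EFinP; exact: measurable_indic.
  - move=> x Ox; rewrite -EFinM lee_fin indicE.
    have [XA|XA] := boolP (x \in A); first by rewrite mulr1 ge_min lexx orbT.
    rewrite mulr0 ge_min leNgt; apply/orP; left; apply/negP => x0.
    by move/negP: XA; apply; rewrite inE.
have sliceP : eps * upper_content Omega Z phi [set x | Omega x /\ (0 < X1 x)%R]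
    <= phi X2.
  apply: le_trans (upper_content_markov Omega Z Z1 phi phi_lin phi_ge0 X2 eps e0 hX2 X20).
  rewrite ler_pM2l//; apply: upper_contentS => // x [Ox].
  rewrite /X1 lt_max ltxx orbF subr_gt0.
  by move=> eX; split => //; rewrite /X2 le_min ltW/=.
apply: le_trans (leeD (ih _ hX1 X1n) sliceE) _.
rewrite -EFinD lee_fin lerD2r [in leRHS]X12 (positive_functionalD Omega Z)//.
by rewrite lerD2l.
Qed.

Let phi1_ge0 : 0 <= phi (fun=> 1).
Proof. by apply: phi_ge0 => //; exact: CZ_cst. Qed.

(** Slices of height [eps] leave a surplus of at most [eps * phi 1], whatever their number; the
    bound [M] makes finitely many suffice. *)
Lemma pairing_le_bounded X (M : R) : CZ Omega Z X ->
  (forall x, Omega x -> 0 <= X x <= M) ->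
  (pairing Omega X mu <= (phi X)%:E)%E.
Proof.
move=> hX XM; apply/lee_addgt0Pr => e e0.
have p1 : 0 < phi (fun=> 1) + 1 by rewrite ltr_wpDl.
pose eps := e / (phi (fun=> 1) + 1).
have eps0 : 0 < eps by rewrite divr_gt0.
apply: le_trans (pairing_le_sliced eps (Num.truncn (M / eps)).+1 X eps0 hX _) _.
  move=> x Ox; have /andP[-> XMx]/= := XM x Ox; apply: (le_trans XMx).
  by rewrite -ler_pdivrMr//; exact/ltW/truncnS_gt.
rewrite -EFinD lee_fin lerD2l.
set u := upper_content _ _ _ _.
have up : u <= phi (fun=> 1) + 1.
  by apply: le_trans (upper_content_leT Omega Z Z1 phi phi_ge0 _) _; rewrite ?lerDl.
by rewrite /eps mulrAC ler_pdivrMr// ler_pM2l.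
Qed.

(** The upper bound applied to [M - X] is the missing lower bound for [X], since constants are
    integrated exactly. *)
Lemma pairing_bounded X (M : R) : CZ Omega Z X ->
  (forall x, Omega x -> 0 <= X x <= M) ->
  pairing Omega X mu = (phi X)%:E.
Proof.
move=> hX XM; have X0 x : Omega x -> 0 <= X x by move=> /XM /andP[].
apply/eqP; rewrite eq_le (pairing_le_bounded X M hX XM)/=.
have CM := CZ_cst Omega Z Z1 M.
have hMX : CZ Omega Z (fun x => M - X x) by exact: CZ_B.
have MX0 x : Omega x -> 0 <= M - X x <= M.
  by move=> Ox; have /andP[X0x XMx] := XM x Ox; rewrite subr_ge0 XMx gerBl.
have := pairing_le_bounded _ M hMX MX0; rewrite (positive_functionalB Omega Z)//.
have := pairingD_ge0 _ _ hMX hX (fun x Ox => proj1 (andP (MX0 x Ox))) X0.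
have -> : (fun x => M - X x + X x) = fun=> M by apply/funext => x; rewrite subrK.
rewrite pairing_cst.
have -> : phi (fun=> M) = M * phi (fun=> 1).
  rewrite -(positive_functionalZ Omega Z Z1)//; last exact: CZ_cst.
  by congr phi; apply/funext => x; rewrite mulr1.
have Xfin : pairing Omega X mu \is a fin_num.
  rewrite ge0_fin_numE ?pairing_ge0//.
  by apply: le_lt_trans (pairing_le_bounded _ M hX XM) _; rewrite ltry.
rewrite -(fineK Xfin) => h1 h2.
have := leeD2r (fine (pairing Omega X mu))%:E h2.
by rewrite -h1 -EFinD !lee_fin -addrA lerDl addrC subr_ge0.
Qed.

(** Truncations [min X n] are integrated exactly. Monotone convergence yields [<= phi X]; for the
    converse, [X] is at most a truncation plus a multiple of [(Z - z)^+], on which [phi] is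
    small. *)
Lemma pairing_ge0E X : CZ Omega Z X -> (forall x, Omega x -> 0 <= X x) ->
  pairing Omega X mu = (phi X)%:E.
Proof.
move=> hX X0; pose Y (n : nat) x := Num.min (X x) n%:R.
have hY n : CZ Omega Z (Y n) by apply: CZ_min => //; exact: CZ_cst.
have Y0n n x : Omega x -> 0 <= Y n x <= n%:R.
  by move=> Ox; rewrite /Y le_min X0// ler0n ge_min lexx orbT.
have Y0 n x : Omega x -> 0 <= Y n x by move=> /(Y0n n) /andP[].
have YX n x : Y n x <= X x by rewrite ge_min lexx.
have pY n : pairing Omega (Y n) mu = (phi (Y n))%:E.
  exact: (pairing_bounded (Y n) n%:R (hY n) (Y0n n)).
have Yinc x : {homo Y^~ x : n m / (n <= m)%N >-> n <= m}.
  by move=> n m nm; rewrite /Y le_min !ge_min lexx/= ler_nat nm orbT.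
apply/eqP; rewrite eq_le; apply/andP; split.
  have -> : pairing Omega X mu =
      limn (fun n => pairing Omega (Y n) mu).
    have Ye0 n x : Omega x -> (0 <= (Y n x)%:E)%E by move=> /(Y0 n).
    have Yeinc x : Omega x ->
        {homo (fun n => (Y n x)%:E) : n m / (n <= m)%N >-> (n <= m)%E}.
      by move=> _ n m nm; rewrite lee_fin Yinc.
    rewrite -(monotone_convergence mu mO (fun n => mX _ (hY n)) Ye0 Yeinc).
    apply: eq_integral => x _; apply/esym/cvg_lim => //.
    apply: (@cvg_near_cst _ _ (X x)%:E) => //.
    exists (Num.truncn (X x)).+1 => // n /= Xn; congr (_%:E).
    apply/min_idPl; apply: (@le_trans _ _ (Num.truncn (X x)).+1%:R).
      exact/ltW/truncnS_gt.
    by rewrite ler_nat.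
  apply: lime_le.
    apply: ereal_nondecreasing_is_cvgn => n m nm.
    by apply: pairing_le => // x Ox; [exact: Y0|exact: Yinc].
  apply: nearW => n; rewrite pY lee_fin.
  by apply: (positive_functional_le Omega Z) => // x Ox.
apply/lee_addgt0Pr => e e0.
have /(CZP _ _ Z1)[_ [c c0 Xc]] := hX.
have c1 : 0 < c + 1 by rewrite ltr_wpDl.
have ec : 0 < e / (c + 1) by rewrite divr_gt0.
have [z z0 tailz] := phi_tail _ ec.
(* From [X <= c Z] and [(c + 1) z <= n] follows [X <= (c + 1) (Z - z) + n], needed where [X > n].
   Using [c + 1] keeps the divisor of [e] positive. *)
pose n := (Num.truncn ((c + 1) * z)).+1.
have Ctail : CZ Omega Z (fun x => Num.max (Z x - z) 0).
  apply: CZ_max => //; last exact: CZ_cst.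
  by apply: CZ_B => //; [exact: CZ_Z|exact: CZ_cst].
have : phi X <= phi (fun x => (c + 1) * Num.max (Z x - z) 0 + Y n x).
  apply: (positive_functional_le Omega Z) => //; first exact: CZ_lin.
  move=> x Ox; have Zx : 1 <= Z x := Z1 _ Ox.
  have zn : (c + 1) * z <= n%:R by exact/ltW/truncnS_gt.
  have := Xc x Ox; rewrite ger0_norm ?X0// => XcZ.
  rewrite /Y; have [Xn|Xn] := leP (X x) n%:R.
    by rewrite lerDr mulr_ge0 ?le_max ?lexx ?orbT// ltW.
  apply: (@le_trans _ _ ((c + 1) * (Z x - z) + n%:R)).
    by rewrite mulrBr; lra.
  by rewrite lerD2r ler_pM2l// le_max lexx.
rewrite phi_lin// => h.
apply: (@le_trans _ _ ((phi (Y n))%:E + e%:E)%E).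
  rewrite -EFinD lee_fin; apply: (le_trans h); rewrite addrC lerD2l.
  by rewrite mulrC -ler_pdivlMr.
by rewrite leeD2r// -pY; apply: pairing_le => // x Ox; exact: Y0.
Qed.

(** [X] is the difference of [X + c Z] and [c Z], both nonnegative on [Omega], in C_Z, and of finite
    integral. *)
Lemma pairingE X : CZ Omega Z X -> pairing Omega X mu = (phi X)%:E.
Proof.
move=> hX; have /(CZP _ _ Z1)[_ [c c0 Xc]] := hX.
have hZ : CZ Omega Z (fun x => c * Z x) by apply: CZ_scale => //; exact: CZ_Z.
have hY : CZ Omega Z (fun x => X x + c * Z x) by exact: CZ_D.
have cZ0 x : Omega x -> 0 <= c * Z x.
  by move=> Ox; rewrite mulr_ge0//; apply: le_trans (Z1 _ Ox).
have Y0 x : Omega x -> 0 <= X x + c * Z x.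
  by move=> Ox; have := Xc x Ox; rewrite ler_norml -subr_ge0 opprK addrC => /andP[].
have int W : CZ Omega Z W -> (forall x, Omega x -> 0 <= W x) ->
    mu.-integrable Omega (EFin \o (W : BorelAmb R J T -> R)).
  move=> hW W0; apply/integrableP; split; first exact: mX.
  apply: (@le_lt_trans _ _ (pairing Omega W mu)); last first.
    by rewrite pairing_ge0E// ltry.
  rewrite le_eqVlt; apply/orP; left; apply/eqP/eq_integral => x.
  by rewrite inE => Ox /=; rewrite ger0_norm ?W0.
transitivity (pairing Omega (fun x => X x + c * Z x)%R mu -
    pairing Omega (fun x => c * Z x)%R mu)%E; last first.
  rewrite !pairing_ge0E// (positive_functionalD Omega Z)//.
  by rewrite -EFinB addrK.
rewrite /pairing -(integralB_EFin mO (int _ hY Y0) (int _ hZ cZ0)).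
by apply: eq_integral => x _; rewrite -EFinB addrK.
Qed.

End representation.

Lemma daniell_representation {R : realType} {J T : nat}
    (Omega : set (Amb R J T)) (Z : Amb R J T -> R)
    (phi : (Amb R J T -> R) -> R) :
  (forall x, Omega x -> 1 <= Z x) ->
  {within Omega, continuous Z} ->
  (forall z : R, 0 <= z -> compact [set x | Omega x /\ Z x <= z]) ->
  (forall a X Y, CZ Omega Z X -> CZ Omega Z Y ->
     phi (fun x => a * X x + Y x) = a * phi X + phi Y) ->
  (forall X, CZ Omega Z X -> (forall x, Omega x -> 0 <= X x) -> 0 <= phi X) ->
  (forall e : R, 0 < e ->
     exists2 z : R, 0 <= z & phi (fun x => Num.max (Z x - z) 0) <= e) ->
  exists2 mu, caZ Omega Z mu &
    forall X, CZ Omega Z X -> pairing Omega X mu = (phi X)%:E.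
Proof.
move=> Z1 cZ Zc phi_lin phi_ge0 phi_tail.
have [|||||mu muE] := @borel_measure_of_content R (Amb R J T) (upper_content Omega Z phi).
- exact: upper_content_null.
- exact: upper_content_ge0.
- exact: upper_contentS.
- exact: upper_content_bigcup.
- by move=> U E; exact: upper_content_split.
have rep X : CZ Omega Z X -> pairing Omega X mu = (phi X)%:E by exact: pairingE.
exists mu => //; split; last by rewrite rep ?ltry//; exact: CZ_Z.
by rewrite muE upper_content_null.
Qed.

(** * Duality *)

(** The increment of [psi] at [X] is convex and vanishes at 0, so it has a linear minorant. The
    codomain [R^o] supplies the module structure on functions, and C_Z enters as the predicate
    [P]. *)
Lemma subgradient {R : realType} {J T : nat} (Omega : set (Amb R J T))
    (Z : Amb R J T -> R) (psi : (Amb R J T -> R) -> R) (X : Amb R J T -> R) :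
  (forall x, Omega x -> 1 <= Z x) ->
  (forall X Y (l : R), CZ Omega Z X -> CZ Omega Z Y -> 0 <= l <= 1 ->
     psi (fun x => l * X x + (1 - l) * Y x) <= l * psi X + (1 - l) * psi Y) ->
  CZ Omega Z X ->
  exists phi : (Amb R J T -> R) -> R,
    (forall a U V, CZ Omega Z U -> CZ Omega Z V ->
       phi (fun x => a * U x + V x) = a * phi U + phi V) /\
    (forall Y, CZ Omega Z Y -> phi Y <= psi (fun x => X x + Y x) - psi X).
Proof.
move=> Z1 psi_cvx hX.
have P0 : (CZ Omega Z : set (Amb R J T -> R^o)) 0 by exact: CZ_cst.
have PL (a : R) (U V : Amb R J T -> R^o) :
    CZ Omega Z U -> CZ Omega Z V -> CZ Omega Z (a *: U + V).
  by move=> hU hV; exact: CZ_lin.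
apply: (linear_minorant _ P0 PL (fun Y => psi (fun x => X x + Y x) - psi X)).
split.
  move=> U V l hU hV l01.
  have -> : (fun x => X x + (l *: U + (1 - l) *: V) x) =
      fun x => l * (X x + U x) + (1 - l) * (X x + V x).
    by apply/funext => x; rewrite /= !mulrDr addrACA -mulrDl subrKC mul1r.
  have := psi_cvx _ _ l (CZ_D _ _ Z1 _ _ hX hU) (CZ_D _ _ Z1 _ _ hX hV) l01.
  lra.
have -> : (fun x => X x + (0 : Amb R J T -> R^o) x) = X.
  by apply/funext => x; rewrite addr0.
by rewrite subrr.
Qed.

(* [X] may fail to be integrable for [mu]; the bound then rests on the
   conventions [+oo - +oo = -oo] and [-oo + y = -oo]. *)
Lemma pairing_sub_conj_le {R : realType} {J T : nat} (Omega : set (Amb R J T))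
    (Z : Amb R J T -> R) (psi : (Amb R J T -> R) -> R) (X : Amb R J T -> R)
    (mu : {measure set (BorelAmb R J T) -> \bar R}) :
  CZ Omega Z X ->
  (pairing Omega X mu - conj_CZ Omega Z psi mu <= (psi X)%:E)%E.
Proof.
move=> hX.
have : (pairing Omega X mu - (psi X)%:E <= conj_CZ Omega Z psi mu)%E.
  by apply: ereal_sup_ubound; exists X.
case: (pairing Omega X mu) => [a| |]; case: (conj_CZ Omega Z psi mu) => [b| |];
  rewrite /= ?addeNy ?addNye ?leNye//.
by rewrite -!EFinB !lee_fin; lra.
Qed.

Theorem theoremA1 (R : realType) (J T : nat) (hT : (0 < T)%N)
  (Omega : set (Amb R J T)) (Z : Amb R J T -> R)
  (psi : (Amb R J T -> R) -> R) :
  Omega !=set0 ->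
  in_state_space Omega ->
  (forall x, Omega x -> 1 <= Z x) ->
  {within Omega, continuous Z} ->
  (forall z : R, 0 <= z -> compact [set x | Omega x /\ Z x <= z]) ->
  (* psi is increasing on C_Z *)
  (forall X Y, CZ Omega Z X -> CZ Omega Z Y ->
     (forall x, Omega x -> Y x <= X x) -> psi Y <= psi X) ->
  (* psi is convex on C_Z *)
  (forall X Y (l : R), CZ Omega Z X -> CZ Omega Z Y -> 0 <= l <= 1 ->
     psi (fun x => l * X x + (1 - l) * Y x) <= l * psi X + (1 - l) * psi Y) ->
  (* continuity condition *)
  (forall X, CZ Omega Z X -> exists2 eps : R, 0 < eps &
     psi (fun x => X x + eps * Num.max (Z x - z) 0) @[z --> +oo] --> psi X) ->
  forall X, CZ Omega Z X ->
    (psi X)%:E =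
      ereal_sup [set (pairing Omega X mu - conj_CZ Omega Z psi mu)%E
                | mu in caZ Omega Z] /\
    exists2 mu, caZ Omega Z mu &
      (psi X)%:E = (pairing Omega X mu - conj_CZ Omega Z psi mu)%E.
Proof.
move=> _ _ Z1 cZ Zcompact psi_inc psi_cvx psi_cont X hX.
have [phi [phi_lin phi_sub]] := subgradient Omega Z psi X Z1 psi_cvx hX.
have phi_ge0 Y : CZ Omega Z Y -> (forall x, Omega x -> 0 <= Y x) -> 0 <= phi Y.
  move=> hY Y0; have hN : CZ Omega Z (fun x => - 1 * Y x) by exact: CZ_scale.
  have hXN : CZ Omega Z (fun x => X x + - 1 * Y x) by exact: CZ_D.
  have := phi_sub _ hN; rewrite (positive_functionalZ Omega Z Z1)//.
  have : psi (fun x => X x + - 1 * Y x) <= psi X.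
    by apply: psi_inc => // x Ox; have := Y0 x Ox; lra.
  lra.
have Ctail z : CZ Omega Z (fun x => Num.max (Z x - z) 0).
  apply: CZ_max => //; last exact: CZ_cst.
  by apply: CZ_B => //; [exact: CZ_Z|exact: CZ_cst].
have phi_tail e : 0 < e ->
    exists2 z : R, 0 <= z & phi (fun x => Num.max (Z x - z) 0) <= e.
  move=> e0; have [eps eps0 /cvgrPdist_lt psi_lim] := psi_cont X hX.
  (* Since [eps] depends on [X] alone, the increment of [psi] can be taken below [eps * e], and
     homogeneity of [phi] then cancels [eps]. *)
  have [z [z0 zlim]] : exists z : R, 0 <= z /\
      `|psi X - psi (fun x => X x + eps * Num.max (Z x - z) 0)| < eps * e.
    apply: (@filter_ex _ (pinfty_nbhs R)); apply: filterI.
      exact: nbhs_pinfty_ge.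
    by apply: psi_lim; rewrite mulr_gt0.
  exists z => //; rewrite -(ler_pM2l eps0) -(positive_functionalZ Omega Z Z1)//.
  apply: le_trans (phi_sub _ _) _; first exact: CZ_scale.
  by move: zlim; rewrite distrC => /ltW; exact: le_trans (ler_norm _).
have [mu mu_caZ rep] :=
  daniell_representation Omega Z phi Z1 cZ Zcompact phi_lin phi_ge0 phi_tail.
(* The subgradient inequality in direction [Y - X] says that [phi Y - psi Y] is largest at [Y = X];
   the conjugate is thus finite at [mu]. *)
have conjE : conj_CZ Omega Z psi mu = (phi X - psi X)%:E.
  apply/eqP; rewrite eq_le; apply/andP; split; last first.
    by apply: ereal_sup_ubound; exists X => //; rewrite rep.
  apply: ge_ereal_sup => _ [Y hY <-]; rewrite rep// -EFinB lee_fin.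
  have := phi_sub _ (CZ_B Omega Z Z1 _ _ hY hX).
  rewrite (positive_functionalB Omega Z)//.
  have -> : (fun x => X x + (Y x - X x)) = Y by apply/funext => x; rewrite subrKC.
  lra.
have attained : (psi X)%:E = (pairing Omega X mu - conj_CZ Omega Z psi mu)%E.
  by rewrite rep// conjE -EFinB opprB subrKC.
split; last by exists mu.
apply/eqP; rewrite eq_le; apply/andP; split.
  by apply: ereal_sup_ubound; exists mu.
by apply: ge_ereal_sup => _ [nu _ <-]; exact: pairing_sub_conj_le.
Qed.
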